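(* For every integer $n\ge 1$ and every price vector $\boldsymbol X=(X_1,\dots,X_{n+1})$ of pairwise distinct non-negative reals, the Random Transaction algorithm $\mathrm{ALG}$ for SPVT described in the context satisfies $$\frac{\max\{X_1,\dots,X_{n+1}\}}{\mathrm{ALG}(\boldsymbol X)}\le \frac{4e^2}{e^2+1}.$$ That is, the strong competitive ratio of this algorithm is at most $\frac{4e^2}{e^2+1}\approx 3.523$.
   Context: SPVT (secretary problem variant trading): there are $n$ buyers with non-negative prices $X_1,\dots,X_n$ and one seller with non-negative price $X_{n+1}$ (together: $n+1$ agents); all prices are assumed pairwise distinct. The seller initially holds one item; the intermediary and the buyers hold none. The agents arrive one by one in a uniformly random order; on arrival an agent reveals its price and whether it is a buyer or the seller. On each arrival the intermediary must immediately and irrevocably decide whether to trade: it may buy the item from the seller when the seller arrives, and it may sell the item to an arriving buyer only if it currently holds it. With $Y_i\in\{0,1\}$ indicating that a trade with agent $i$ takes place, the social welfare is $\sum_{i=1}^n X_iY_i+X_{n+1}(1-Y_{n+1})$, i.e. the price of the agent finally holding the item ($0$ if the intermediary ends up with it). $\mathrm{ALG}(\boldsymbol X)$ is the expected social welfare (over the random order and the algorithm's randomness). The strong offline optimum is $\mathrm{OPT}(\boldsymbol X)=\max\{X_1,\dots,X_{n+1}\}$, and the strong competitive ratio is the worst case of $\mathrm{OPT}(\boldsymbol X)/\mathrm{ALG}(\boldsymbol X)$ over $\boldsymbol X$. Random Transaction algorithm. Draw $n+1$ independent uniform random numbers on $[0,1]$, sort them as $T_1<\dots<T_{n+1}$,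 and regard $T_i$ as the arrival time of the $i$-th arriving agent (so the arrival times of the $n+1$ agents are i.i.d. uniform on $[0,1]$). 1. If the seller's arrival time is later than $(e-1)/e$ and the seller's price is higher than the prices of all agents arriving before it, the intermediary makes no trade at all (the algorithm stops, and the seller keeps the item). Otherwise the intermediary buys the item from the seller on its arrival. 2. After buying, let $b$ be the earliest buyer arriving after the purchase such that $b$'s arrival time is after $1/e$ and $b$'s price is higher than the prices of all agents (buyers and seller) arriving before $b$. If such $b$ exists, sell the item to $b$; otherwise make no sale. *)

(* Defs.v *)
From HB Require Import structures.
From mathcomp Require Import all_boot all_order all_algebra all_fingroup.
From mathcomp Require Import all_classical all_reals all_analysis.

Set Implicit Arguments.
Unset Strict Implicit.
Unset Printing Implicit Defensive.

Import Order.TTheory GRing.Theory Num.Theory.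
Local Open Scope ring_scope.

(* The agents are 'I_n.+1: the buyers are the i != ord_max (equivalently the
   lift ord_max i with i : 'I_n) and the seller is ord_max. *)
Definition seller {n : nat} : 'I_n.+1 := ord_max.

(* All prices are non-negative and pairwise distinct. *)
Definition admissible_prices (R : realType) (n : nat) (X : 'I_n.+1 -> R) : Prop :=
  (forall i, 0 <= X i) /\ injective X.

(* Y i tells whether a trade with agent i takes place. *)
Definition social_welfare (R : realType) (n : nat)
    (X : 'I_n.+1 -> R) (Y : 'I_n.+1 -> bool) : R :=
  \sum_(i < n) X (lift seller i) * (Y (lift seller i))%:R
    + X seller * (1 - (Y seller)%:R).

Definition strong_opt (R : realType) (n : nat) (X : 'I_n.+1 -> R) : R :=
  \big[Num.max/X seller]_(i < n.+1) X i.

Section RandomTransaction.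
Variables (R : realType) (n : nat).
Variables (X : 'I_n.+1 -> R).
(* Agent i is the (pos i)-th one to arrive (counting from 0), and the k-th
   arrival takes place at time T k. *)
Variables (pos : {perm 'I_n.+1}) (T : 'I_n.+1 -> R).

Definition arrival_time (i : 'I_n.+1) : R := T (pos i).

Definition arrives_before (i j : 'I_n.+1) : bool := (pos i < pos j)%N.

Definition best_so_far (i : 'I_n.+1) : bool :=
  [forall j, arrives_before j i ==> (X j < X i)].

Definition rt_buys : bool :=
  ~~ (((expR 1 - 1) / expR 1 < arrival_time seller) && best_so_far seller).

Definition rt_eligible (b : 'I_n.+1) : bool :=
  [&& b != seller, arrives_before seller b,
      (expR 1)^-1 < arrival_time b & best_so_far b].

Definition rt_sells_to (b : 'I_n.+1) : bool :=
  [&& rt_buys, rt_eligible b &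
      [forall c, rt_eligible c ==> ~~ arrives_before c b]].

Definition rt_trades (i : 'I_n.+1) : bool :=
  if i == seller then rt_buys else rt_sells_to i.

Definition rt_welfare : R := social_welfare X rt_trades.

End RandomTransaction.

(* The k-th smallest (counting from 0) of the numbers U i. *)
Definition order_stat (R : realType) (n : nat) (U : 'I_n.+1 -> R)
    (k : 'I_n.+1) : R :=
  nth 0 (sort <=%R [seq U i | i <- enum 'I_n.+1]) k.

(* The arrival order pos is uniformly distributed over the permutations, the
   U i are uniformly distributed on [0, 1], and pos, U 0, ..., U n are mutually
   independent. The product rule for subfamilies is the case A i = setT,
   respectively the sum over s. *)
Record random_arrivals d (Omega : measurableType d) (R : realType)
    (P : probability Omega R) (n : nat)
    (pos : Omega -> {perm 'I_n.+1}) (U : 'I_n.+1 -> {RV P >-> R}) : Prop := {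
  order_measurable : forall s, measurable (pos @^-1` [set s])%classic ;
  order_uniform : forall s,
    P (pos @^-1` [set s])%classic = ((n.+1)`!%:R^-1)%:E ;
  time_uniform : forall i (A : set R), measurable A ->
    distribution P (U i) A = uniform_prob (@ltr01 R) A ;
  order_time_independent : forall s (A : 'I_n.+1 -> set R),
    (forall i, measurable (A i)) ->
    P (pos @^-1` [set s] `&` \bigcap_i (U i @^-1` A i))%classic
    = (P (pos @^-1` [set s])%classic
       * \prod_(i < n.+1) P (U i @^-1` A i)%classic)%E
}.

(* Expected social welfare of the Random Transaction algorithm. *)
Definition rt_alg d (Omega : measurableType d) (R : realType)
    (P : probability Omega R) (n : nat)
    (pos : Omega -> {perm 'I_n.+1}) (U : 'I_n.+1 -> {RV P >-> R})
    (X : 'I_n.+1 -> R) : \bar R :=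
  ('E_P[fun w => rt_welfare X (pos w) (order_stat (fun i => U i w))])%E.

(* In \bar R the inverse of 0 is +oo, so that a vanishing expected welfare
   yields an infinite ratio. *)
Definition rt_ratio d (Omega : measurableType d) (R : realType)
    (P : probability Omega R) (n : nat)
    (pos : Omega -> {perm 'I_n.+1}) (U : 'I_n.+1 -> {RV P >-> R})
    (X : 'I_n.+1 -> R) : \bar R :=
  ((strong_opt X)%:E / rt_alg pos U X)%E.

Definition rt_strong_competitive_ratio d (Omega : measurableType d)
    (R : realType) (P : probability Omega R) (n : nat)
    (pos : Omega -> {perm 'I_n.+1}) (U : 'I_n.+1 -> {RV P >-> R}) : \bar R :=
  ereal_sup [set rt_ratio pos U X | X in @admissible_prices R n]%classic.

(* Main.v *)
(* The arrival times of the agents are i.i.d. uniform. If the seller is the best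
   agent it keeps the item as soon as it arrives after (e-1)/e, which has
   probability 1/e. Otherwise let m be the best buyer, arriving at time t, and
   let the seller arrive at time s < t, with t > 1/e. The item is sold to m when
   the best agent, among the seller and the buyers outbidding it, that arrives
   before m is either the seller, with s < (e-1)/e, or a buyer arriving before
   max(s, 1/e). Conditionally on s and t, with h buyers other than m outbidding
   the seller and q = (1-t)^h, these events have probabilities q [s < (e-1)/e]
   and sum_(i < h) (1-t)^i max(s, 1/e) = (1-q) max(s, 1/e) / t. Integrating over
   s < t gives at least (t + e^-2/t)/2 whatever q is, and integrating over
   1/e < t < 1 gives (1 + e^-2)/4. *)

Require Import Defs.
From HB Require Import structures.
From mathcomp Require Import all_boot all_order all_algebra all_fingroup.
From mathcomp Require Import all_classical all_reals all_analysis.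
From mathcomp Require Import measurable_realfun ring lra.

Import Order.TTheory GRing.Theory Num.Theory.
Import numFieldNormedType.Exports.
Local Open Scope ring_scope.

(** * Independent families of random variables *)

Section IndependentEvents.
Local Open Scope classical_set_scope.
Local Open Scope ereal_scope.
Context d (Omega : measurableType d) (R : realType) (P : probability Omega R).
Context d2 (S : measurableType d2) (mu : probability S R).
Context (I : eqType) (V : I -> Omega -> S).
Hypothesis mV : forall i, measurable_fun setT (V i).

(** Joint independence and the laws are encoded together: taking every [B i] to be [setT] shows that
    [Z] has law [nu], and each [V i] with [i] in [l] has law [mu]. *)
Definition independent_from {d1} {T : measurableType d1}
    (Z : Omega -> T) (nu : set T -> \bar R) (l : seq I) :=
  forall A (B : I -> set S), measurable A -> (forall i, measurable (B i)) ->
  P [set w | A (Z w) /\ forall i, i \in l -> B i (V i w)]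
  = nu A * \prod_(i <- l) mu (B i).

Lemma measurable_forall_in (l : seq I) (D : I -> set Omega) :
  (forall i, measurable (D i)) ->
  measurable [set w | forall i, i \in l -> D i w].
Proof.
move=> mD; elim: l => [|k l IH].
  by rewrite (_ : [set _ | _] = setT)//; apply/seteqP; split.
rewrite (_ : [set _ | _] = D k `&` [set w | forall i, i \in l -> D i w]).
  exact: measurableI.
apply/seteqP; split => w /=.
  move=> h; split=> [|i il]; apply: h; rewrite inE ?eqxx// il orbT//.
by move=> [Dk Dl] i; rewrite inE => /predU1P[->|/Dl].
Qed.

Lemma measurable_independent_event d1 (T : measurableType d1)
    (Z : Omega -> T) (l : seq I) (A : set T) (C : I -> set (T * S)) :
  measurable_fun setT Z -> measurable A -> (forall i, measurable (C i)) ->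
  measurable [set w | A (Z w) /\ forall i, i \in l -> C i (Z w, V i w)].
Proof.
move=> mZ mA mC; apply: measurableI.
  by rewrite -[X in measurable X]setTI; exact: mZ.
apply: (@measurable_forall_in l (fun i w => C i (Z w, V i w))) => i.
rewrite -[X in measurable X]setTI.
by apply: (measurable_fun_pair mZ (mV i)).
Qed.

(** The hypothesis gives the product rule only on rectangles of [(Z, V k)]. With the remaining
    variables confined to a fixed box, both sides are finite measures in [D] that agree on
    rectangles, hence everywhere. *)
Lemma independent_from_cons d1 (T : measurableType d1) (Z : Omega -> T)
    (nu : probability T R) (k : I) (l : seq I) :
  measurable_fun setT Z -> k \notin l -> independent_from Z nu (k :: l) ->
  independent_from (fun w => (Z w, V k w)) (nu \x mu) l.
Proof.
move=> mZ kl ind D B mD mB.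
pose box := [set w | forall i, i \in l -> B i (V i w)].
have mbox : measurable box.
  apply: (@measurable_forall_in l (fun i w => B i (V i w))) => i.
  by rewrite -[X in measurable X]setTI; exact: mV.
have mZV : measurable_fun setT (fun w => (Z w, V k w)).
  exact: measurable_fun_pair.
have ik i : i \in l -> (i == k) = false.
  by move=> il; apply: contraNF kl => /eqP <-.
have cfin : \prod_(i <- l) mu (B i) \is a fin_num.
  by apply: prode_fin_num => i _; exact: fin_num_measure.
have c0 : 0 <= \prod_(i <- l) mu (B i) by apply: prode_ge0.
have cr0 : (0 <= fine (\prod_(i <- l) mu (B i)))%R by apply: fine_ge0.
(* Uniqueness concerns product measures, so the constant contributed by the box is absorbed into the
   factor [nu]; [scale_prod] pulls it out again. *)
pose m1 := mscale (NngNum cr0) nu.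
have uniq_prod X : measurable X ->
    (m1 \x mu) X = pushforward (mrestr P mbox) (fun w => (Z w, V k w)) X.
  move=> mX; apply: product_measure_unique => // A' B' mA' mB'.
  rewrite /m1 /= /mscale /pushforward /mrestr /= fineK//.
  have mB2 i : measurable (if i == k then B' else B i) by case: ifP.
  have := ind _ _ mA' mB2.
  rewrite big_cons eqxx (_ : [set w | _] =
    (fun w => (Z w, V k w)) @^-1` (A' `*` B') `&` box).
    move=> ->; rewrite [in RHS](muleC _ (nu A')) -muleA; congr (_ * _).
    rewrite muleC; congr (_ * _); apply: eq_big_seq => i il.
    by rewrite ik.
  apply/seteqP; split => w /=.
    move=> [Aw h]; split.
      by split=> //; have := h k; rewrite inE eqxx/=; apply.
    move=> i il; have := h i; rewrite inE il orbT ik//; exact.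
  move=> [[Aw Bw] h]; split=> // i; rewrite inE => /predU1P[->|il].
    by rewrite eqxx.
  by rewrite ik//; exact: h.
have scale_prod X : measurable X ->
    (m1 \x mu) X = mscale (NngNum cr0) (nu \x mu) X.
  move=> mX; apply: product_measure_unique => // A' B' mA' mB'.
  by rewrite /m1 /= /mscale/= product_measure1E//= muleA.
have -> : [set w | D (Z w, V k w) /\ forall i, i \in l -> B i (V i w)] =
  (fun w => (Z w, V k w)) @^-1` D `&` box by [].
transitivity ((m1 \x mu) D); first by rewrite uniq_prod.
by rewrite scale_prod//= /mscale fineK// muleC.
Qed.

Lemma emeasurable_prod d1 (T : measurableType d1) (J : Type) (l : seq J)
    (h : J -> T -> \bar R) : (forall i, measurable_fun [set: T] (h i)) ->
  measurable_fun [set: T] (fun x => \prod_(i <- l) h i x).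
Proof.
move=> mh; elim: l => [|k l IH].
  by under eq_fun do rewrite big_nil; exact: measurable_cst.
by under eq_fun do rewrite big_cons; exact: emeasurable_funM.
Qed.

(** Conditionally on [Z], the constraints on the [V i] are independent. The induction moves one
    variable at a time from the list into [Z], which is why the space of [Z] is quantified after
    [l]; Tonelli then integrates that variable out. *)
Lemma independent_event_integral (l : seq I) : uniq l ->
  forall d1 (T : measurableType d1) (Z : Omega -> T) (nu : probability T R),
  measurable_fun setT Z -> independent_from Z nu l ->
  forall (A : set T) (C : I -> set (T * S)),
  measurable A -> (forall i, measurable (C i)) ->
  P [set w | A (Z w) /\ forall i, i \in l -> C i (Z w, V i w)]
  = \int[nu]_(z in A) \prod_(i <- l) mu (xsection (C i) z).
Proof.
elim: l => [_|k l IH /= /andP[kl ul]] d1 T Z nu mZ ind A C mA mC.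
  have := ind A (fun=> setT) mA (fun=> measurableT).
  rewrite (eq_set (Q := fun w => A (Z w) /\
    forall i, i \in [::] -> C i (Z w, V i w))); last first.
    by move=> w; apply/propext; split => -[].
  move=> ->; rewrite big_nil mule1.
  under eq_integral do rewrite big_nil.
  by rewrite integral_cst// mul1e.
have mZV : measurable_fun setT (fun w => (Z w, V k w)).
  exact: measurable_fun_pair.
(* The constraint on [V k] becomes part of the condition on the enlarged variable [(Z, V k)]. *)
pose A' := (A `*` setT) `&` C k.
have mA' : measurable A' by apply: measurableI => //; exact: measurableX.
pose C' i := [set x : (T * S) * S | C i (x.1.1, x.2)].
have mC' i : measurable (C' i).
  rewrite -[X in measurable X]setTI; apply: measurable_fun_pair => //.
  by apply: measurableT_comp => //; exact: measurable_fst.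
have indV := independent_from_cons _ _ _ _ _ _ mZ kl ind.
have := IH ul _ _ _ _ mZV indV A' C' mA' mC'.
rewrite (_ : [set w | _] =
    [set w | A (Z w) /\ (forall i, i \in k :: l -> C i (Z w, V i w))]).
  move=> ->; pose g z := \prod_(i <- l) mu (xsection (C i) z).
  have g0 z : 0 <= g z by apply: prode_ge0 => i _.
  have mg : measurable_fun setT g.
    apply: emeasurable_prod => i _; exact: measurable_fun_xsection.
  have mgA : measurable_fun setT (g \_ A).
    by apply/(measurable_restrictT _ mA); exact: measurable_funTS.
  have gA0 z : 0 <= (g \_ A) z by rewrite patchE; case: ifP.
  have mCk : measurable_fun setT (fun z => (\1_(C k) z)%:E : \bar R).
    exact/measurable_EFinP/measurable_indic.
  transitivity (\int[nu \x mu]_z ((g \_ A) z.1 * (\1_(C k) z)%:E)).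
    rewrite integral_mkcond; apply: eq_integral => -[x v] _.
    rewrite !patchE /A' in_setI in_setX/= in_setT andbT indicE.
    case: (x \in A); case: (_ \in C k); rewrite ?mul0e ?mule0// mule1.
    by apply: eq_bigr => i _; congr (mu _).
  rewrite fubini_tonelli1//=; last 2 first.
  - apply: emeasurable_funM => //; exact: measurableT_comp.
  - by move=> z; rewrite mule_ge0// lee_fin.
  rewrite [RHS]integral_mkcond; apply: eq_integral => x _.
  rewrite /fubini_F/= ge0_integralZl//; last first.
    by exact: measurableT_comp mCk (pair1_measurable x).
  rewrite (eq_integral (fun v => (\1_(xsection (C k) x) v)%:E)); last first.
    by move=> v _; rewrite !indicE mem_xsection.
  rewrite integral_indic// ?setIT; last exact: measurable_xsection.
  by rewrite !patchE; case: ifP => _; rewrite ?mul0e// big_cons muleC.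
apply/seteqP; split => w /=.
  move=> [[[Aw _] Ck] h]; split=> // i; rewrite inE => /predU1P[->//|il].
  exact: (h i).
move=> [Aw h]; split; first split=> //; first by apply: h; rewrite inE eqxx.
by move=> i il; apply: h; rewrite inE il orbT.
Qed.

End IndependentEvents.

Arguments independent_from {d Omega R} P {d2 S} mu {I} V {d1 T}.

(** * Order statistics *)

Section OrderStatistics.
Context (R : realType) (n : nat).
Implicit Types u : 'I_n.+1 -> R.

Lemma order_stat_nondecreasing u (i j : 'I_n.+1) :
  (i <= j)%N -> order_stat u i <= order_stat u j.
Proof.
move=> ij; rewrite /order_stat.
apply: (sorted_leq_nth le_trans lexx) => //.
- exact: sort_le_sorted.
- by rewrite inE size_sort size_map size_enum_ord.
- by rewrite inE size_sort size_map size_enum_ord.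
Qed.

(** Sorting the indices by their values, instead of the values themselves, produces the permutation
    even when there are ties. *)
Lemma order_stat_perm u :
  exists r : {perm 'I_n.+1}, forall k, order_stat u k = u (r k).
Proof.
pose leu := relpre u <=%R.
pose s := sort leu (enum 'I_n.+1).
have size_s : size s = n.+1 by rewrite size_sort size_enum_ord.
have inj_nth : injective (fun k : 'I_n.+1 => nth ord0 s k).
  move=> i j /eqP; rewrite nth_uniq ?size_s ?ltn_ord ?sort_uniq ?enum_uniq//.
  by move/eqP/val_inj.
exists (perm inj_nth) => k; rewrite permE /order_stat sort_map.
by rewrite (nth_map ord0)// size_s.
Qed.

(** Two sorted rearrangements of one list coincide, so any permutation that sorts [u] computes the
    order statistics, however it breaks ties. *)
Lemma order_stat_sorted u (r : {perm 'I_n.+1}) :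
  (forall i j : 'I_n.+1, (i <= j)%N -> u (r i) <= u (r j)) ->
  forall k, order_stat u k = u (r k).
Proof.
move=> ndu k; rewrite /order_stat.
have -> : sort <=%R [seq u i | i <- enum 'I_n.+1] =
          [seq u (r i) | i <- enum 'I_n.+1].
  apply: (@sorted_eq _ <=%R); [exact: le_trans|exact: le_anti| | |].
  - exact: sort_le_sorted.
  - rewrite sorted_map; apply: (@sub_sorted _ (relpre val leq)).
      by move=> i j /ndu.
    by rewrite -sorted_map val_enum_ord iota_sorted.
  - rewrite perm_sort (map_comp u r) perm_map//; apply: uniq_perm.
    + exact: enum_uniq.
    + by rewrite map_inj_uniq ?enum_uniq//; exact: perm_inj.
    + move=> i; rewrite mem_enum; apply/esym/mapP.
      by exists (r^-1%g i); rewrite ?mem_enum// permKV.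
by rewrite (nth_map ord0) ?size_enum_ord// nth_ord_enum.
Qed.

End OrderStatistics.

(** Integrate the pointwise equality of the two counting functions. With [K] a singleton this is
    additivity over a partition. *)
Lemma sum_measure_eq d (T : measurableType d) (R : realType)
    (P : {measure set T -> \bar R}) (J K : finType)
    (F : J -> set T) (G : K -> set T) :
  (forall j, measurable (F j)) -> (forall k, measurable (G k)) ->
  (forall w, \sum_j \1_(F j) w = \sum_k \1_(G k) w :> R) ->
  (\sum_j P (F j) = \sum_k P (G k))%E.
Proof.
have sumE (I : finType) (H : I -> set T) : (forall i, measurable (H i)) ->
    (\sum_i P (H i) = \int[P]_w (\sum_i \1_(H i) w)%:E)%E.
  move=> mH; under [RHS]eq_integral do rewrite -sumEFin.
  rewrite ge0_integral_sum//; last first.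
    by move=> i; apply/measurable_EFinP/measurable_indic.
  by apply: eq_bigr => i _; rewrite integral_indic// setIT.
move=> mF mG FG; rewrite sumE// sumE//.
by apply: eq_integral => w _; rewrite FG.
Qed.

(** * Eliminating the order statistics from events about arrival times *)

Section RandomArrivals.
Local Open Scope classical_set_scope.
Context (R : realType) d (Omega : measurableType d) (P : probability Omega R).
Context (n : nat) (pos : Omega -> {perm 'I_n.+1}) (U : 'I_n.+1 -> {RV P >-> R}).
Hypothesis arrivals : random_arrivals pos U.

(** Summing the product rule over all arrival orders, whose probabilities add up to 1, leaves the
    rule for the times alone. *)
Lemma times_independent (A : 'I_n.+1 -> set R) :
  (forall i, measurable (A i)) ->
  P (\bigcap_i (U i @^-1` A i))
  = (\prod_(i < n.+1) uniform_prob (@ltr01 R) (A i))%E.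
Proof.
move=> mA; have mbox : measurable (\bigcap_i (U i @^-1` A i)).
  apply: fin_bigcap_measurable => [|i _]; first exact: finite_finset.
  by rewrite -[X in measurable X]setTI; exact: measurable_funP.
have := @sum_measure_eq _ _ _ P {perm 'I_n.+1} unit
  (fun s => pos @^-1` [set s] `&` \bigcap_i (U i @^-1` A i))
  (fun=> \bigcap_i (U i @^-1` A i)).
rewrite big_const card_unit/= adde0 => <-//; last 2 first.
- move=> s; apply: measurableI => //; exact: (order_measurable arrivals).
- move=> w; rewrite big_const card_unit/= addr0 (bigD1 (pos w))//=.
  rewrite big1 ?addr0 => [|s sw].
    by rewrite !indicE in_setI (mem_set (_ : (_ @^-1` _) w)).
  by rewrite indicE memNset// => -[/= ws _]; move: sw; rewrite ws eqxx.
under eq_bigr do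
  rewrite (order_time_independent arrivals)// (order_uniform arrivals).
rewrite -ge0_sume_distrl; last by move=> s _; rewrite lee_fin.
rewrite sumEFin sumr_const card_Sn -[X in (X%:E * _)%E]mulr_natr.
rewrite mulVf ?mul1e; last first.
  by rewrite pnatr_eq0 -lt0n fact_gt0.
by apply: eq_bigr => i _; rewrite -(time_uniform arrivals i (mA i)).
Qed.

(** A pi-system generating the sigma-algebra of the times. The product rule of [random_arrivals]
    speaks of boxes only, while events about order statistics are not boxes. *)
Let boxes : set (set Omega) := [set Q | exists A : 'I_n.+1 -> set R,
  (forall i, measurable (A i)) /\ Q = \bigcap_i (U i @^-1` A i)].

(** Both sides are finite measures in [Q] that agree on the pi-system [boxes], hence on the
    sigma-algebra it generates. *)
Lemma order_independent (s : {perm 'I_n.+1}) (Q : set Omega) :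
  <<s boxes >> Q ->
  P (pos @^-1` [set s] `&` Q) = ((n.+1)`!%:R^-1%:E * P Q)%E.
Proof.
have c0 : 0 <= (n.+1)`!%:R^-1 :> R by rewrite invr_ge0.
have mpos := order_measurable arrivals s.
have sub_boxes : boxes `<=` measurable.
  move=> _ [A [mA ->]].
  apply: fin_bigcap_measurable => [|i _]; first exact: finite_finset.
  by rewrite -[X in measurable X]setTI; exact: measurable_funP.
move=> sQ; rewrite setIC.
transitivity (mscale (NngNum c0) P Q); last by [].
apply: (@g_sigma_algebra_measure_unique _ _ _ boxes _ (fun=> setT) _ _
  (mrestr P mpos)) => //.
- move=> _; exists (fun=> setT); split=> //.
  by apply/seteqP; split.
- by rewrite bigcup_const.
- move=> _ _ [A [mA ->]] [B [mB ->]]; exists (fun i => A i `&` B i); split.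
    by move=> i; exact: measurableI.
  by rewrite -bigcapI.
- move=> _ [A [mA ->]]; rewrite /= /mrestr /mscale/= setIC.
  rewrite (order_time_independent arrivals)// (order_uniform arrivals).
  rewrite times_independent//; congr (_ * _)%E.
  by apply: eq_bigr => i _; rewrite -(time_uniform arrivals i (mA i)).
- move=> _; rewrite /= /mrestr setTI.
  by rewrite (le_lt_trans (probability_le1 _ _)) ?ltry.
Qed.

Lemma boxes_measurable (Q : set Omega) : <<s boxes >> Q -> measurable Q.
Proof.
apply: smallest_sub; first exact: sigma_algebra_measurable.
move=> _ [A [mA ->]].
apply: fin_bigcap_measurable => [|i _]; first exact: finite_finset.
by rewrite -[X in measurable X]setTI; exact: measurable_funP.
Qed.

Section Event.
Variable E : ('I_n.+1 -> R) -> Prop.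
Hypothesis mE : forall d' (T : measurableType d') (f : 'I_n.+1 -> T -> R),
  (forall i, measurable_fun setT (f i)) ->
  measurable [set x | E (fun i => f i x)].

(** The event is a finite union over [r] of the events where [r] sorts the times and [E] holds for
    the times rearranged by [r]. Since [mE] covers every measurable space, it applies to [Omega]
    with the sigma-algebra of the times. *)
Lemma order_stat_event_boxes (s : {perm 'I_n.+1}) :
  <<s boxes >> [set w | E (fun i => order_stat (fun j => U j w) (s i))].
Proof.
pose O' := g_sigma_algebraType boxes.
have mU i : measurable_fun (setT : set O') (U i : O' -> R).
  move=> _ A mA; apply: sub_sigma_algebra.
  exists (fun j => if j == i then A else setT); split.
    by move=> j; case: ifP.
  rewrite setTI; apply/seteqP; split => w /=.
    by move=> Aw j _; case: eqP => [->|].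
  by move=> /(_ i I); rewrite eqxx.
pose B (r : {perm 'I_n.+1}) : set O' :=
  [set w | forall i j : 'I_n.+1, (i <= j)%N -> U (r i) w <= U (r j) w]
  `&` [set w | E (fun i => U (r (s i)) w)].
suff -> : [set w | E (fun i => order_stat (fun j => U j w) (s i))] =
    \bigcup_r B r.
  apply: (@fin_bigcup_measurable _ O') => [|r _]; first exact: finite_finset.
  apply: measurableI; last by apply: mE => i; exact: mU.
  rewrite (_ : [set w | _] = \bigcap_(i in [set: 'I_n.+1])
      \bigcap_(j in [set j : 'I_n.+1 | (i <= j)%N])
      [set w | U (r i) w <= U (r j) w]); last first.
    by apply/seteqP; split => w /= h i; [move=> _ j; exact: h|
      move=> j; exact: h].
  apply: fin_bigcap_measurable => [|i _]; first exact: finite_finset.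
  apply: fin_bigcap_measurable => [|j _]; first exact: finite_finset.
  by rewrite -[X in measurable X]setTI; exact: measurable_fun_le.
apply/seteqP; split => w /=.
  have [r rE] := order_stat_perm _ _ (fun j => U j w).
  rewrite (_ : (fun i => _) = fun i => U (r (s i)) w); last first.
    by apply/funext => i; rewrite rE.
  move=> Ew; exists r => //; split=> // i j ij; rewrite -!rE.
  exact: order_stat_nondecreasing.
move=> [r _ [/= ndr Er]].
have rE := order_stat_sorted _ _ (fun j => U j w) r ndr.
rewrite (_ : (fun i => order_stat _ _) = fun i => U (r (s i)) w)//.
by apply/funext => i; rewrite rE.
Qed.

Let M (s : {perm 'I_n.+1}) :=
  [set w | E (fun i => order_stat (fun j => U j w) (s i))].

Let mposM s : measurable (pos @^-1` [set s] `&` M s).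
Proof.
apply: measurableI; first exact: (order_measurable arrivals).
exact: (boxes_measurable _ (order_stat_event_boxes s)).
Qed.

Let order_stat_eventE :
  [set w | E (fun i => order_stat (fun j => U j w) (pos w i))] =
  \bigcup_s (pos @^-1` [set s] `&` M s).
Proof.
apply/seteqP; split => w /=; first by move=> Ew; exists (pos w).
by move=> [s _ [/= ->]].
Qed.

Lemma measurable_order_stat_event :
  measurable [set w | E (fun i => order_stat (fun j => U j w) (pos w i))].
Proof.
rewrite order_stat_eventE; apply: fin_bigcup_measurable => //.
exact: finite_finset.
Qed.

(* Summing over the arrival orders erases the sorting: U is a rearrangement of
   its order statistics, and s |-> s * r permutes the orders. *)
Lemma order_stat_average :
  P [set w | E (fun i => order_stat (fun j => U j w) (pos w i))]
  = ((n.+1)`!%:R^-1%:E *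
     \sum_(t : {perm 'I_n.+1}) P [set w | E (fun i => U (t i) w)])%E.
Proof.
rewrite order_stat_eventE.
have := @sum_measure_eq _ _ _ P {perm 'I_n.+1} unit
  (fun s => pos @^-1` [set s] `&` M s)
  (fun=> \bigcup_s (pos @^-1` [set s] `&` M s)).
rewrite big_const card_unit/= adde0 => <-//; last 2 first.
- move=> _; apply: fin_bigcup_measurable => //; exact: finite_finset.
- move=> w; rewrite big_const card_unit/= addr0 (bigD1 (pos w))//=.
  rewrite big1 ?addr0 => [|s sw].
    rewrite !indicE; congr (_%:R); congr nat_of_bool.
    apply/idP/idP; rewrite !inE/=; first by move=> h; exists (pos w).
    by move=> [s _ [/= ->]].
  by rewrite indicE memNset// => -[/= ws _]; move: sw; rewrite ws eqxx.
(* Once the order is fixed to [s], the event depends on the times alone, so the probability of [s]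
   factors out. *)
rewrite (eq_bigr (fun s => (n.+1)`!%:R^-1%:E * P (M s))%E); last first.
  by move=> s _; apply: order_independent; exact: order_stat_event_boxes.
rewrite -ge0_sume_distrr//; congr (_ * _)%E.
apply: sum_measure_eq => [s|t|w].
- exact: (boxes_measurable _ (order_stat_event_boxes s)).
- by apply: mE => i; exact: measurable_funP.
have [r rE] := order_stat_perm _ _ (fun j => U j w).
rewrite [RHS](reindex_inj (mulIg r)); apply: eq_bigr => s _.
have sE : (fun i => order_stat (fun j => U j w) (s i)) =
    (fun i => U ((s * r)%g i) w) by apply/funext => i; rewrite rE permM.
rewrite !indicE; congr (nat_of_bool _)%:R.
by apply/idP/idP; rewrite !inE /M/= sE.
Qed.

End Event.

End RandomArrivals.

(** * Deterministic analysis of the algorithm *)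

Section Welfare.
Context (R : realType) (n : nat) (X : 'I_n.+1 -> R).
Hypothesis X0 : forall i, 0 <= X i.

Lemma social_welfare_ge0 Y : 0 <= social_welfare X Y.
Proof.
rewrite addr_ge0 ?sumr_ge0// => [i _|]; first by rewrite mulr_ge0.
by rewrite mulr_ge0// subr_ge0; case: (Y _).
Qed.

Lemma social_welfare_trade (Y : _ -> bool) m : m != seller -> Y m ->
  X m <= social_welfare X Y.
Proof.
case: (unliftP seller m) => [i ->|-> /eqP//] _ Ym.
rewrite /social_welfare (bigD1 i)//= Ym mulr1 -addrA lerDl addr_ge0//.
  by rewrite sumr_ge0// => k _; rewrite mulr_ge0.
by rewrite mulr_ge0// subr_ge0; case: (Y _).
Qed.

Lemma social_welfare_keep (Y : _ -> bool) : ~~ Y seller ->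
  X seller <= social_welfare X Y.
Proof.
move=> /negbTE Ys; rewrite /social_welfare Ys subr0 mulr1 lerDr.
by rewrite sumr_ge0// => k _; rewrite mulr_ge0.
Qed.

End Welfare.

Lemma expR1_ge2 (R : realType) : 2 <= expR 1 :> R.
Proof. by have := expR_ge1Dx (1 : R). Qed.

(** A seller arriving after (e-1)/e also arrives after 1/e, so its time is then the maximum in
    [sale_event]. *)
Lemma invr_expR1_le (R : realType) : (expR 1)^-1 <= (expR 1 - 1) / expR 1 :> R.
Proof.
rewrite -[leLHS]mul1r ler_pM2r ?invr_gt0 ?expR_gt0//.
by have := expR1_ge2 R; lra.
Qed.

Section Sale.
Context (R : realType) (n : nat) (X : 'I_n.+1 -> R) (m : 'I_n.+1).
Hypothesis X_inj : injective X.
Hypothesis m_buyer : m != seller.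
Hypothesis m_max : forall i, X i <= X m.

Definition better (j : 'I_n.+1) := [pred k | (k != m) && (X j < X k)].

Definition leader (j : 'I_n.+1) := (j != m) && (X seller <= X j).

(* The item is sold to the best buyer m, and j is the best agent, other than m
   and among the seller and the buyers outbidding it, that arrives before m. *)
Definition sale_event (V : 'I_n.+1 -> R) (j : 'I_n.+1) : bool :=
  [&& V seller < V m, (expR 1)^-1 < V m,
      (if j == seller then V seller < (expR 1 - 1) / expR 1
       else V j < Num.max (V seller) (expR 1)^-1)
    & [forall (k | better j k), V m < V k]].

(** Let [j'] have the larger price. If [j'] is the seller, the prices coincide. Otherwise, if [j']
    differed from [j], it would be better than [j] and so arrive after [m], whereas its own event
    places it before the seller or before 1/e, both of which precede [m]. *)
Lemma sale_event_disjoint V j j' : leader j -> leader j' ->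
  sale_event V j -> sale_event V j' -> j = j'.
Proof.
wlog jj' : j j' / X j <= X j' => [W|].
  case/orP: (le_total (X j) (X j')) => le_jj' lj lj' Ej Ej'; first exact: W.
  exact/esym/W.
move=> /andP[_ sj] /andP[j'm _] /and4P[_ _ _ /forallP/(_ j')].
move=> /implyP h /and4P[sm em + _].
case: eqP => [j's _|_]; first by apply: X_inj; apply: le_anti; rewrite jj' j's.
rewrite lt_max => Vj'; apply/eqP/negPn/negP => neq.
have bj : better j j'.
  rewrite /better/= j'm lt_neqAle jj' andbT.
  by apply: contra neq => /eqP/X_inj->.
have := h bj; case/orP: Vj' => Vj' mj'.
  by have := lt_trans (lt_trans mj' Vj') sm; rewrite ltxx.
by have := lt_trans (lt_trans mj' Vj') em; rewrite ltxx.
Qed.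

Variables (pos : {perm 'I_n.+1}) (T : 'I_n.+1 -> R).
Hypothesis T_nd : forall i j : 'I_n.+1, (i <= j)%N -> T i <= T j.

Let V i := T (pos i).

(** The times may have ties: a strict inequality of times implies the order of arrival, but the
    order implies only a weak inequality. *)
Let arrives_before_lt i j : V i < V j -> arrives_before pos i j.
Proof.
move=> ij; rewrite /arrives_before ltnNge; apply: contraTN ij => /T_nd.
by rewrite -leNgt.
Qed.

Let arrives_before_le i j : arrives_before pos i j -> V i <= V j.
Proof. by move=> /ltnW/T_nd. Qed.

Lemma sale_event_sells j : leader j -> sale_event V j ->
  rt_sells_to X pos T m.
Proof.
move=> /andP[jm sj] /and4P[sm em Vj /forallP bj].
have best_before c i :
    best_so_far X pos i -> arrives_before pos c i -> X c < X i.
  by move=> /forallP/(_ c)/implyP.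
apply/and3P; split.
(* Were the seller late and best so far, [j] would be a buyer and the maximum would be the seller's
   own time; then [j], priced at least as high as the seller, would arrive before it. *)
- rewrite /rt_buys /arrival_time -/(V seller); apply/negP => /andP[sa bs].
  move: Vj; case: eqP => [_|_]; first by rewrite ltNge (ltW sa).
  rewrite max_l; last exact: le_trans (invr_expR1_le R) (ltW sa).
  by move=> /arrives_before_lt /(best_before _ _ bs); rewrite ltNge sj.
- rewrite /rt_eligible m_buyer arrives_before_lt//=; apply/andP; split=> //.
  apply/forallP => i; apply/implyP => im; rewrite lt_neqAle m_max andbT.
  by apply/eqP => /X_inj im'; move: im; rewrite im' /arrives_before ltnn.
(* An eligible [c] before [m] outbids the seller but not [j], since the agents better than [j]
   arrive after [m]. Hence [j] is a buyer arriving before the maximum of the seller's time and 1/e,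
   thus before [c], and [c] is not best so far. *)
- apply/forallP => c; apply/implyP => /and4P[cs sc ec bc]; apply/negP => cm.
  have Xsc := best_before _ _ bc sc.
  have cj : X c <= X j.
    rewrite leNgt; apply/negP => jc.
    have /implyP := bj c; rewrite /better/= jc andbT => h.
    have {}h : V m < V c.
      by apply: h; apply/eqP => cm'; move: cm; rewrite cm' /arrives_before ltnn.
    by move: (arrives_before_le _ _ cm); rewrite leNgt h.
  have js : j != seller by apply: contraTneq cj => ->; rewrite -ltNge.
  move: Vj; rewrite (negbTE js) => Vj.
  have /(best_before _ _ bc) : arrives_before pos j c.
    apply: arrives_before_lt; apply: lt_le_trans Vj _.
    by rewrite ge_max (arrives_before_le _ _ sc) (ltW ec).
  by rewrite ltNge cj.
Qed.

Hypothesis X0 : forall i, 0 <= X i.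

Lemma sale_event_welfare j : leader j -> sale_event V j ->
  X m <= rt_welfare X pos T.
Proof.
move=> lj Ej; apply: social_welfare_trade => //.
by rewrite /rt_trades (negbTE m_buyer); exact: sale_event_sells lj Ej.
Qed.

End Sale.

Arguments better {R n}.
Arguments leader {R n}.
Arguments sale_event {R n}.

Lemma keep_welfare (R : realType) (n : nat) (X : 'I_n.+1 -> R)
    (pos : {perm 'I_n.+1}) (T : 'I_n.+1 -> R) :
  injective X -> (forall i, 0 <= X i) -> (forall i, X i <= X seller) ->
  (expR 1 - 1) / expR 1 < T (pos seller) -> X seller <= rt_welfare X pos T.
Proof.
move=> X_inj X0 s_max sa; apply: social_welfare_keep => //.
rewrite /rt_trades eqxx /rt_buys negbK /arrival_time sa/=.
apply/forallP => i; apply/implyP => im; rewrite lt_neqAle s_max andbT.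
by apply/eqP => /X_inj im'; move: im; rewrite im' /arrives_before ltnn.
Qed.

(** * Integrals over the unit interval *)

Lemma measurable_bool_set d (T : measurableType d) (f : T -> bool) :
  measurable_fun setT f -> measurable [set x | f x]%classic.
Proof.
move=> mf; rewrite -[X in measurable X]setTI.
exact: (mf measurableT [set true]%classic I).
Qed.

Lemma measurable_bool_natr d (T : measurableType d) (R : realType)
    (f : T -> bool) :
  measurable_fun setT f -> measurable_fun setT (fun x => (f x)%:R : R).
Proof.
move=> mf; rewrite (_ : (fun _ => _) = \1_[set x | f x]%classic).
  exact/measurable_indic/measurable_bool_set.
by apply/funext => x; rewrite indicE; congr (nat_of_bool _)%:R;
  apply/idP/idP; rewrite inE.
Qed.

Section UniformIntegrals.
Local Open Scope classical_set_scope.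
Context (R : realType).
Local Notation mu := (@lebesgue_measure R).
Local Notation lambda := (uniform_prob (@ltr01 R)).

Lemma uniform_prob01E (A : set R) : measurable A ->
  lambda A = mu (A `&` `[0%R, 1%R])%classic.
Proof.
move=> mA; rewrite /uniform_prob integral_uniform_pdf.
rewrite (eq_integral (fun=> 1%E)).
  by rewrite integral_cst ?mul1e//; exact: measurableI.
move=> x; rewrite inE/= in_itv/= => -[_ x01].
by rewrite /uniform_pdf x01 subr0 invr1.
Qed.

Lemma uniform_prob01_lt (x : R) : 0 <= x <= 1 ->
  lambda [set v | v < x]%classic = x%:E.
Proof.
move=> /andP[x0 x1]; rewrite uniform_prob01E; last first.
  by apply: measurable_bool_set; exact: measurable_fun_ltr.
rewrite (_ : (_ `&` _)%classic = `[0, x[%classic).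
  rewrite lebesgue_measure_itv/= lte_fin; case: ltrP => [_|]; last first.
    by move=> x0'; congr EFin; apply: le_anti; rewrite x0 x0'.
  by rewrite sube0.
apply/seteqP; split => v /=; rewrite !in_itv/=.
  by move=> [-> /andP[->]].
by move=> /andP[-> vx]; split=> //; exact: ltW (lt_le_trans vx x1).
Qed.

Lemma uniform_prob01_gt (x : R) : 0 <= x <= 1 ->
  lambda [set v | x < v]%classic = (1 - x)%:E.
Proof.
move=> /andP[x0 x1]; rewrite uniform_prob01E; last first.
  by apply: measurable_bool_set; exact: measurable_fun_ltr.
rewrite (_ : (_ `&` _)%classic = `]x, 1]%classic).
  rewrite lebesgue_measure_itv/= lte_fin; case: ltrP => [//|x1'].
  by congr EFin; rewrite (_ : x = 1) ?subrr//; apply: le_anti; rewrite x1.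
apply/seteqP; split => v /=; rewrite !in_itv/=.
  by move=> [-> /andP[_ ->]].
move=> /andP[xv ->]; split=> //; rewrite andbT.
exact: ltW (le_lt_trans x0 xv).
Qed.

Lemma integral_itvoo_derive (f F : R -> R) (a b : R) : a < b ->
  (forall x, a <= x <= b -> is_derive x (1 : R) F (f x)) ->
  (forall x, a <= x <= b -> {for x, continuous f}) ->
  (\int[mu]_(x in `]a, b[) (f x)%:E = (F b - F a)%:E)%E.
Proof.
move=> ab dF cf.
have cF x : a <= x <= b -> {for x, continuous F}.
  by move=> /dF Fx; apply: differentiable_continuous; exact/derivable1_diffP.
have cfab : {within `[a, b]%classic, continuous f}.
  by apply: continuous_in_subspaceT => x; rewrite inE/= in_itv; exact: cf.
rewrite -(@integral_itv_bndoo _ _ _ (EFin \o f) true false); last first.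
  apply/measurable_EFinP.
  apply: measurable_funS (subspace_continuous_measurable_fun _ cfab) => //.
  exact: subset_itv_oo_cc.
rewrite (@continuous_FTC2 _ f F)//.
- split.
  + by move=> x; rewrite in_itv/= => /andP[/ltW ax /ltW xb];
      have [] := dF x; rewrite ?ax.
  + by apply: cvg_at_right_filter; apply: cF; rewrite lexx ltW.
  + by apply: cvg_at_left_filter; apply: cF; rewrite lexx ltW.
- move=> x; rewrite in_itv/= => /andP[/ltW ax /ltW xb].
  by rewrite derive1E; apply: derive_val; apply: dF; rewrite ax.
Qed.

Lemma integral_id_itv (b t : R) : b < t ->
  (\int[mu]_(s in `]b, t[) s%:E = ((t ^+ 2 - b ^+ 2) / 2)%:E)%E.
Proof.
move=> bt; rewrite mulrBl.
apply: (@integral_itvoo_derive id (fun x => x ^+ 2 / 2)) => //.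
- move=> x _; apply: is_derive_eq; rewrite /GRing.scale/=; by field.
- by move=> x _; exact: cvg_id.
Qed.

(** On [0, b] the maximum is [b], contributing b^2; on ]b, t[ it is [s], contributing (t^2 -
    b^2)/2. *)
Lemma integral_max_ge (b t : R) : 0 < b -> b < t -> t <= 1 ->
  (((t ^+ 2 + b ^+ 2) / 2)%:E <=
   \int[mu]_(s in `[0%R, 1%R]) ((s < t)%R%:R * Num.max s b)%:E)%E.
Proof.
move=> b0 bt t1.
have mf (D : set R) :
    measurable_fun D (fun s : R => ((s < t)%R%:R * Num.max s b)%:E).
  apply: measurable_funTS; apply/measurable_EFinP; apply: measurable_funM.
    by apply: measurable_bool_natr; exact: measurable_fun_ltr.
  exact: measurable_maxr.
have f0 (s : R) : 0 <= s -> (0 <= ((s < t)%R%:R * Num.max s b)%:E)%E.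
  by move=> s0; rewrite lee_fin mulr_ge0// le_max s0.
apply: (@le_trans _ _ (\int[mu]_(s in `[0%R, b] `|` `]b, t[)
    ((s < t)%R%:R * Num.max s b)%:E)%E); last first.
  apply: ge0_subset_integral => //.
  - exact: measurableU.
  - exact: mf.
  - by move=> s /=; rewrite in_itv/= => /andP[/f0].
  - move=> s /=; rewrite !in_itv/= => -[] /andP[s0 sb]; apply/andP; split.
    + by [].
    + exact: le_trans sb (le_trans (ltW bt) t1).
    + exact: ltW (lt_trans b0 s0).
    + exact: ltW (lt_le_trans sb t1).
rewrite ge0_integral_setU//; last 3 first.
- exact: mf.
- move=> s /=; rewrite !in_itv/= => -[] /andP[s0 sb]; apply: f0 => //.
  exact: ltW (lt_trans b0 s0).
- apply/disj_setPS => s /=; rewrite !in_itv/= => -[/andP[_ sb] /andP[bs _]].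
  by move: bs; rewrite ltNge sb.
rewrite (eq_integral (fun=> b%:E)); last first.
  move=> s; rewrite inE/= in_itv/= => /andP[_ sb].
  by rewrite (le_lt_trans sb bt) mul1r max_r.
rewrite integral_cst//= lebesgue_measure_itv/= lte_fin b0 sube0.
rewrite [X in (_ + X)%E](_ : _ = ((t ^+ 2 - b ^+ 2) / 2)%:E)%E; last first.
  rewrite -integral_id_itv//; apply: eq_integral => s.
  rewrite inE/= in_itv/= => /andP[bs st].
  by rewrite st mul1r max_l// ltW.
rewrite -EFinM -EFinD lee_fin.
by rewrite le_eqVlt; apply/orP; left; apply/eqP; field.
Qed.

Lemma integral_lt_min (t a : R) : 0 <= t <= 1 -> 0 <= a <= 1 ->
  (\int[mu]_(s in `[0%R, 1%R]) ((s < t) && (s < a))%R%:R%:E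
   = (Num.min t a)%:E)%E.
Proof.
move=> /andP[t0 t1] /andP[a0 a1].
transitivity (\int[mu]_(s in `[0%R, 1%R])
    (\1_[set s : R | (s < Num.min t a)%R] s)%:E)%E.
  apply: eq_integral => s _; rewrite indicE; congr (nat_of_bool _)%:R%:E.
  by rewrite -lt_min; apply/idP/idP; rewrite inE.
have mlt : measurable [set s : R | (s < Num.min t a)%R].
  by apply: measurable_bool_set; exact: measurable_fun_ltr.
rewrite integral_indic//.
apply: etrans (esym (uniform_prob01E _ mlt)) _; rewrite uniform_prob01_lt//.
by rewrite le_min t0 a0 ge_min t1.
Qed.

Lemma continuous_outer_integrand (b t : R) : 0 < t ->
  {for t, continuous (fun x : R => (x + b ^+ 2 / x) / 2)}.
Proof.
move=> t0; apply: cvgM; last exact: cvg_cst.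
apply: cvgD; first exact: cvg_id.
apply: cvgM; first exact: cvg_cst.
by apply: cvgV; [rewrite gt_eqF|exact: cvg_id].
Qed.

(** An antiderivative is x^2/4 + (b^2/2) ln x. For b = 1/e, where ln b = -1, the value is (1 +
    e^-2)/4. *)
Lemma integral_outer (b : R) : 0 < b -> b < 1 ->
  (\int[mu]_(t in `]b, 1%R[) ((t + b ^+ 2 / t) / 2)%:E
   = ((1 - b ^+ 2) / 4 - b ^+ 2 / 2 * ln b)%:E)%E.
Proof.
move=> b0 b1.
pose F (x : R) := x ^+ 2 / 4 + b ^+ 2 / 2 * ln x.
pose f (x : R) := (x + b ^+ 2 / x) / 2.
have x0 x : b <= x <= 1 -> 0 < x.
  by move=> /andP[bx _]; exact: lt_le_trans b0 bx.
have dF x : b <= x <= 1 -> is_derive x (1 : R) F (f x).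
  move=> /x0 {}x0; rewrite /F; have dln := is_derive1_ln x0.
  by apply: is_derive_eq; rewrite /GRing.scale/= /f; field; rewrite gt_eqF.
have cf x : b <= x <= 1 -> {for x, continuous f}.
  by move=> /x0; exact: continuous_outer_integrand.
apply: etrans (integral_itvoo_derive f F _ _ b1 dF cf) _.
by rewrite /F ln1; congr EFin; field.
Qed.

End UniformIntegrals.

(** * Probability of selling to the best buyer *)

(** As prices are distinct, the exponents are the ranks 0, ..., |D|-1 and the sum is geometric. The
    induction removes the cheapest element: it has the last rank and does not affect the other
    ranks. *)
Lemma sum_expr_rank (R : realType) (I : finType) (X : I -> R) (y : R)
    (D : {set I}) : injective X ->
  (1 - y) * (\sum_(j in D) y ^+ #|[set k in D | X j < X k]|) = 1 - y ^+ #|D|.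
Proof.
move=> X_inj; have [N] := ubnP #|D|; elim: N D => // N IH D.
have [->|[i iD]] := set_0Vmem D.
  by rewrite big_set0 cards0 expr0 subrr mulr0.
case: (arg_minP X iD) => j Dj jmin; rewrite ltnS => DN.
have jD : j \in D := Dj.
have {}Dj : #|D| = #|D :\ j|.+1 by rewrite (cardsD1 j) jD.
have jlt k : k \in D :\ j -> X j < X k.
  by rewrite in_setD1 => /andP[kj kD]; rewrite lt_neqAle jmin// andbT;
    apply: contra kj => /eqP/X_inj->.
rewrite (big_setD1 j)//= mulrDr.
rewrite (eq_bigr (fun l => y ^+ #|[set k in D :\ j | X l < X k]|)); last first.
  move=> l lD; congr (_ ^+ _); apply: eq_card => k; rewrite !inE.
  by case: eqP => //= ->; rewrite jD/= ltNge ltW ?jlt.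
rewrite IH; last by rewrite -Dj.
rewrite (_ : [set k in D | X j < X k] = D :\ j) ?Dj ?exprS; first by ring.
apply/setP => k; rewrite !inE; case: eqP => [->|/eqP kj].
  by rewrite ltxx andbF.
by case kD : (k \in D) => //=; rewrite jlt// in_setD1 kj.
Qed.

Section SaleProbability.
Local Open Scope classical_set_scope.
Context (R : realType) (n : nat) (X : 'I_n.+1 -> R) (m : 'I_n.+1).
Hypothesis X_inj : injective X.
Hypothesis m_buyer : m != seller.

Local Notation lambda := (uniform_prob (@ltr01 R)).
Local Notation b := (expR 1)^-1.
Local Notation a := ((expR 1 - 1) / expR 1).

Definition others := [seq i <- enum 'I_n.+1 | (i != m) && (i != seller)].

(* A pair z consists of the arrival times of m and of the seller. *)
Definition sale_base (j : 'I_n.+1) : set (R * R) :=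
  [set z | [&& z.2 < z.1, b < z.1 & (j == seller) ==> (z.2 < a)]].

(** A triple consists of the times of [m], of the seller and of agent [i]. Each condition involves a
    single further agent, so given the first two times the conditions are independent. *)
Definition sale_slot (j i : 'I_n.+1) : set (R * R * R) :=
  [set y | if i == j then y.2 < Num.max y.1.2 b
           else better X m j i ==> (y.1.1 < y.2)].

Lemma measurable_sale_base j : measurable (sale_base j).
Proof.
apply: measurable_bool_set; apply: measurable_and.
  exact: measurable_fun_ltr.
apply: measurable_and; first exact: measurable_fun_ltr.
by case: (j == seller) => //=; exact: measurable_fun_ltr.
Qed.

Lemma measurable_sale_slot j i : measurable (sale_slot j i).
Proof.
have m1 : measurable_fun setT (fun y : R * R * R => y.1.1).
  exact: measurableT_comp.
have m2 : measurable_fun setT (fun y : R * R * R => y.1.2).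
  exact: measurableT_comp.
apply: measurable_bool_set; case: (i == j).
  by apply: measurable_fun_ltr => //; exact: measurable_maxr.
by case: (better _ _ _ _) => //=; exact: measurable_fun_ltr.
Qed.

Lemma sale_eventE (Omega : Type) (V : 'I_n.+1 -> Omega -> R) j :
  leader X m j ->
  [set w | sale_event X m (V^~ w) j]
  = [set w | sale_base j (V m w, V seller w) /\ forall i, i \in others ->
      sale_slot j i (V m w, V seller w, V i w)].
Proof.
move=> /andP[jm sj]; apply/seteqP; split => w.
  move=> /and4P[/= sm em Vj /forallP bj]; split.
    rewrite /sale_base/= sm em /=; apply/implyP => js.
    by move: Vj; rewrite js.
  move=> i; rewrite mem_filter => /andP[/andP[im is_] _].
  rewrite /sale_slot/=; case: eqP => [ij|_]; last exact: bj.
  by move: Vj; rewrite -ij (negbTE is_).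
move=> [/= /and3P[/= sm em js] h].
have slot i : i != m -> i != seller ->
    sale_slot j i (V m w, V seller w, V i w).
  by move=> im is_; apply: h; rewrite mem_filter im is_ mem_enum.
apply/and4P; split=> //.
  case: ifPn => [js'|js']; first by move: js; rewrite js'.
  by have := slot j jm js'; rewrite /sale_slot/= eqxx.
apply/forallP => k; apply/implyP => bk; have /andP[km jk] := bk.
have ks : k != seller by apply: contraTneq jk => ->; rewrite -leNgt.
have := slot k km ks; rewrite /sale_slot/= km jk; case: eqP => [kj _|//].
by move: jk; rewrite kj ltxx.
Qed.

(** The conditional probability of [sale_event] for [j], given the times of [m] and of the
    seller. *)
Definition slot_prob (j : 'I_n.+1) : R * R -> \bar R :=
  (fun z => \prod_(i <- others) lambda (xsection (sale_slot j i) z))%E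
    \_ (sale_base j).

Lemma slot_prob_ge0 j z : (0 <= slot_prob j z)%E.
Proof. by rewrite /slot_prob patchE; case: ifP => // _; exact: prode_ge0. Qed.

Lemma measurable_slot_prob j : measurable_fun setT (slot_prob j).
Proof.
apply/(measurable_restrictT _ (measurable_sale_base j)).
apply: measurable_funTS.
apply: emeasurable_prod => i; apply: measurable_fun_xsection.
exact: measurable_sale_slot.
Qed.

(** Each agent better than [j] must arrive after [t], giving a factor 1-t; a buyer [j] gives the
    factor max(s, b), and all others give 1. No better agent is missed by [others]: [better]
    excludes [m], and a leader is not outbid by the seller. *)
Lemma slot_probE j t s : leader X m j -> b < t <= 1 -> 0 <= s <= 1 ->
  slot_prob j (t, s) =
  ((s < t)%R%:R * ((if j == seller then (s < a)%R%:R else Num.max s b)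
    * (1 - t) ^+ #|better X m j|))%:E.
Proof.
move=> /andP[jm sj] /andP[bt t1] /andP[s0 s1].
have b0 : 0 < b :> R by rewrite invr_gt0 expR_gt0.
have b1 : b <= 1 :> R by rewrite invf_le1 ?expR_gt0// -expR0 ler_expR.
have t0 : 0 <= t := ltW (lt_trans b0 bt).
rewrite /slot_prob patchE /sale_base.
have -> : ((t, s) \in [set z : R * R |
    [&& z.2 < z.1, b < z.1 & (j == seller) ==> (z.2 < a)]]) =
    (s < t) && ((j == seller) ==> (s < a)).
  by apply/idP/idP; rewrite inE/= bt.
case: (s < t) => /=; last by rewrite mul0r.
rewrite mul1r; transitivity (((j == seller) ==> (s < a))%R%:R%:E *
  ((if j == seller then 1 else Num.max s b) *
   (1 - t) ^+ #|better X m j|)%:E)%E; last first.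
  rewrite -EFinM; congr EFin; rewrite mulrA; congr (_ * _).
  by case: (j == seller) => /=; rewrite ?mulr1 ?mul1r.
case: (_ ==> _); rewrite ?mul0e// mul1e.
pose r i : R := (if i == j then Num.max s b else 1)
  * (if better X m j i then 1 - t else 1).
rewrite (eq_big_seq (fun i => (r i)%:E)); last first.
  move=> i _; rewrite /r.
  have -> : xsection (sale_slot j i) (t, s) = [set v | if i == j
      then v < Num.max s b else better X m j i ==> (t < v)].
    by apply/seteqP; split => v; rewrite xsectionE.
  case: eqP => [->|_].
    rewrite uniform_prob01_lt; last by rewrite le_max s0 ge_max s1 b1.
    by rewrite /better/= ltxx andbF mulr1.
  rewrite mul1r; case: (better _ _ _ _) => /=.
    by rewrite uniform_prob01_gt// t0.
  rewrite (_ : [set v | true] = setT) ?probability_setT//.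
  by apply/seteqP; split.
rewrite prodEFin big_split/=; congr (_ * _)%:E.
  rewrite big_filter big_enum_cond/= big_mkcond/=.
  rewrite (bigD1 j)//= eqxx jm/= big1 ?mulr1.
    by case: (j == seller).
  by move=> i /negbTE->; case: ifP.
rewrite big_filter big_enum_cond/= big_mkcond/=.
rewrite -prodr_const [RHS]big_mkcond/=; apply: eq_bigr => i _.
rewrite [i \in _]/(better X m j i).
case: ifP => // /negbT; rewrite negb_and !negbK => /orP[]/eqP ->.
  by rewrite /better/= eqxx.
by rewrite /better/= ltNge sj andbF.
Qed.

End SaleProbability.

Arguments others {n}.
Arguments sale_base {R n}.
Arguments sale_slot {R n}.
Arguments slot_prob {R n}.

(** Apply 1 + x <= exp x at x = 1/4 and take fourth powers. The bound it gives on 1/e is below sqrt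
    2 - 1, as [slot_prob_inner] requires. *)
Lemma expR1_lb (R : realType) : (5 / 4) ^+ 4 <= expR 1 :> R.
Proof.
have -> : expR 1 = expR (4^-1) ^+ 4 :> R.
  by rewrite -expRM_natl mulfV.
rewrite lerXn2r ?nnegrE ?expR_ge0//.
by have := expR_ge1Dx (4^-1 : R); lra.
Qed.

Section SaleProbabilityBound.
Local Open Scope classical_set_scope.
Context (R : realType) (n : nat) (X : 'I_n.+1 -> R) (m : 'I_n.+1).
Hypothesis X_inj : injective X.
Hypothesis m_buyer : m != seller.

Local Notation lambda := (uniform_prob (@ltr01 R)).
Local Notation b := (expR 1)^-1.
Local Notation a := ((expR 1 - 1) / expR 1).

Definition leaders := [seq j <- enum 'I_n.+1 | leader X m j].

Let b0 : 0 < b :> R. Proof. by rewrite invr_gt0 expR_gt0. Qed.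

Let aE : a = 1 - b :> R.
Proof. by rewrite mulrBl mulfV ?mul1r// gt_eqF ?expR_gt0. Qed.

Let b_ub : b <= (4 / 5) ^+ 4 :> R.
Proof.
rewrite -[leRHS]invrK lef_pV2 ?posrE ?expR_gt0//.
by rewrite -exprVn invf_div expR1_lb.
Qed.

(** This is [sum_expr_rank] on the set of agents better than the seller, which by distinctness are
    exactly the leaders other than the seller. *)
Lemma sum_expr_better (t : R) :
  t * (\sum_(j | leader X m j && (j != seller))
         (1 - t) ^+ #|better X m j|)
  = 1 - (1 - t) ^+ #|better X m seller|.
Proof.
pose D : {set 'I_n.+1} := [set k | better X m seller k]%SET.
have := sum_expr_rank R _ X (1 - t) D X_inj.
rewrite subKr cardsE => <-; congr (_ * _); apply: eq_big => [j|j].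
  rewrite inE /leader /better/= lt_neqAle andbA andbAC; congr (_ && _).
  by congr (_ && _); rewrite eq_sym (inj_eq X_inj).
move=> /andP[/andP[jm sj] js]; congr (_ ^+ _); apply: eq_card => k.
rewrite !inE /better/=; case: (k != m) => //=.
by apply/idP/andP => [jk|[]//]; split=> //; exact: le_lt_trans jk.
Qed.

(** With w = (t^2 + b^2)/2, integrating over [s] gives at least q min(t, a) + (1-q) w/t. Since w/t
    <= min(t, a), this is at least w/t for every [q] in [0, 1]. *)
Lemma slot_prob_inner t : b < t < 1 ->
  (((t + b ^+ 2 / t) / 2)%:E <=
   \int[lambda]_s \sum_(j <- leaders) slot_prob X m j (t, s))%E.
Proof.
move=> /andP[bt t1]; have t0 : 0 < t := lt_trans b0 bt.
pose q := (1 - t) ^+ #|better X m seller|.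
have q0 : 0 <= q by rewrite exprn_ge0// subr_ge0 ltW.
have q1 : q <= 1 by apply: exprn_ile1; lra.
pose c := \sum_(j | leader X m j && (j != seller))
         (1 - t) ^+ #|better X m j|.
have tc : t * c = 1 - q by exact: sum_expr_better.
have c0 : 0 <= c.
  by rewrite sumr_ge0// => j _; rewrite exprn_ge0// subr_ge0 ltW.
rewrite integral_uniform; last 2 first.
- apply: emeasurable_sum => j.
  by apply: measurableT_comp (pair1_measurable t); exact: measurable_slot_prob.
- by move=> s; apply: sume_ge0 => j _; exact: slot_prob_ge0.
rewrite subr0 invr1 mul1e.
have mlt : measurable_fun setT (fun s : R => (s < t)).
  exact: measurable_fun_ltr.
have m1 : measurable_fun setT
    (fun s : R => ((s < t) && (s < a))%R%:R%:E : \bar R).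
  apply/measurable_EFinP/measurable_bool_natr; apply: measurable_and => //.
  exact: measurable_fun_ltr.
have m2 : measurable_fun setT (fun s : R => ((s < t)%R%:R * Num.max s b)%:E).
  apply/measurable_EFinP; apply: measurable_funM.
    exact: measurable_bool_natr.
  exact: measurable_maxr.
have -> : (\int[lebesgue_measure]_(s in `[0%R, 1%R])
      \sum_(j <- leaders) slot_prob X m j (t, s) =
    \int[lebesgue_measure]_(s in `[0%R, 1%R])
      (q%:E * ((s < t) && (s < a))%R%:R%:E
       + c%:E * ((s < t)%R%:R * Num.max s b)%:E))%E.
  apply: eq_integral => s; rewrite inE/= in_itv/= => s01.
  rewrite /leaders big_filter big_enum_cond/=.
  rewrite (eq_bigr (fun j => ((s < t)%R%:R *
      ((if j == seller then (s < a)%R%:R else Num.max s b)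
       * (1 - t) ^+ #|better X m j|))%:E)); last first.
    by move=> j lj; apply: slot_probE => //; rewrite bt ltW.
  rewrite sumEFin (bigD1 seller)/=; last by rewrite /leader eq_sym m_buyer/=.
  rewrite eqxx -!EFinM -EFinD; congr EFin; congr (_ + _).
    by case: (s < t); case: (s < a); rewrite ?mulr0 ?mul0r ?mulr1 ?mul1r.
  rewrite /c mulr_suml; apply: eq_bigr => j /andP[_ /negbTE->].
  by rewrite mulrA mulrC.
rewrite ge0_integralD//=; last 4 first.
- by move=> s _; rewrite -EFinM lee_fin mulr_ge0.
- exact/measurable_funTS/measurable_funeM.
- move=> s; rewrite in_itv/= => /andP[s0 _].
  by rewrite -EFinM lee_fin !mulr_ge0// le_max s0.
- exact/measurable_funTS/measurable_funeM.
rewrite ge0_integralZl//; last exact/measurable_funTS.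
rewrite ge0_integralZl//; last 2 first.
- exact/measurable_funTS.
- move=> s; rewrite /= in_itv/= => /andP[s0 _].
  by rewrite lee_fin mulr_ge0// le_max s0.
rewrite integral_lt_min ?(ltW t0) ?(ltW t1)//; last first.
  by rewrite aE subr_ge0 gerBl (ltW b0) (le_trans b_ub)//; lra.
apply: (@le_trans _ _ (q%:E * (Num.min t a)%:E +
    c%:E * ((t ^+ 2 + b ^+ 2) / 2)%:E)%E); last first.
  by rewrite leeD2l// lee_wpmul2l ?lee_fin// integral_max_ge// ltW.
rewrite -!EFinM -EFinD lee_fin.
have w_le : (t ^+ 2 + b ^+ 2) / 2 <= t * Num.min t a.
  rewrite minr_pMr ?(ltW t0)// le_min aE; apply/andP; split.
    have := b0; have := bt; set B := b; nra.
  (* The claim is t^2 + b^2 - 2t(1-b) <= 0. By convexity in [t] (the product below) the endpoints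
     suffice: the values 2b(2b-1) at t = b and b^2 + 2b - 1 at t = 1 are negative for b < sqrt 2 -
     1. *)
  have := b_ub; have := b0; have := bt; set B := b => Bt B0 B1.
  have : 0 <= (t - B) * (1 - t) by rewrite mulr_ge0// subr_ge0 ltW.
  nra.
have -> : (t + b ^+ 2 / t) / 2 = (t ^+ 2 + b ^+ 2) / 2 / t.
  by field; rewrite !gt_eqF ?expR_gt0.
rewrite ler_pdivrMr//; move: w_le.
set w := (_ / 2); set mn := Num.min _ _ => w_le.
rewrite mulrDl [c * w * t]mulrAC [c * t]mulrC tc.
have := ler_wpM2l q0 w_le; nra.
Qed.

End SaleProbabilityBound.

Arguments leaders {R n}.

Section SaleEventMeasurable.
Local Open Scope classical_set_scope.
Context (R : realType) (n : nat) (X : 'I_n.+1 -> R) (m : 'I_n.+1).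
Context d (Omega : measurableType d) (V : 'I_n.+1 -> Omega -> R).
Hypothesis mV : forall i, measurable_fun setT (V i).

Lemma measurable_sale_event j : leader X m j ->
  measurable [set w | sale_event X m (V^~ w) j].
Proof.
move=> lj; rewrite sale_eventE//; apply: (@measurable_independent_event
  _ _ _ _ _ V mV _ _ (fun w => (V m w, V seller w))).
- exact: measurable_fun_pair.
- exact: measurable_sale_base.
- by move=> i; exact: measurable_sale_slot.
Qed.

Lemma measurable_sale :
  measurable [set w | exists2 j, leader X m j & sale_event X m (V^~ w) j].
Proof.
rewrite (_ : [set w | _] = \bigcup_(j in [set j | leader X m j])
    [set w | sale_event X m (V^~ w) j]).
  apply: fin_bigcup_measurable => [|j]; first exact: finite_finset.
  exact: measurable_sale_event.
by apply/seteqP; split => w /= [j lj Ej]; exists j.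
Qed.

End SaleEventMeasurable.

Section SaleEventProbability.
Local Open Scope classical_set_scope.
Context (R : realType) (n : nat) (X : 'I_n.+1 -> R) (m : 'I_n.+1).
Hypothesis X_inj : injective X.
Hypothesis m_buyer : m != seller.
Context d (Omega : measurableType d) (P : probability Omega R).
Context (V : 'I_n.+1 -> Omega -> R).

Local Notation lambda := (uniform_prob (@ltr01 R)).
Local Notation b := (expR 1)^-1.

Hypothesis mV : forall i, measurable_fun setT (V i).
Hypothesis V_indep : forall A : 'I_n.+1 -> set R,
  (forall i, measurable (A i)) ->
  P (\bigcap_i (V i @^-1` A i)) = (\prod_(i < n.+1) lambda (A i))%E.

Let times_independent_from :
  independent_from P lambda V (V m) lambda
    (seller :: others m).
Proof.
move=> A B mA mB.
pose A' i := if i == m then A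
  else if i \in seller :: others m then B i else setT.
have mA' i : measurable (A' i).
  rewrite /A'; case: (i == m) => //; case: ifP => _; first exact: mB.
  exact: measurableT.
have m_notin : m \notin seller :: others m.
  by rewrite inE negb_or m_buyer mem_filter eqxx.
have -> : [set w | A (V m w) /\
      (forall i, i \in seller :: others m -> B i (V i w))] =
    \bigcap_i (V i @^-1` A' i).
  apply/seteqP; split => w /=.
    move=> [Aw h] i _; rewrite /A'/=; case: eqP => [->//|_].
    by case: ifP => // /h.
  move=> h; split; first by have := h m I; rewrite /A'/= eqxx.
  move=> i il; have : A' i (V i w) := h i I.
  rewrite /A'; case: eqP => [im|_]; last by case: ifPn => // /negP/(_ il).
  by move: il m_notin; rewrite [in i \in _]im => ->.
rewrite V_indep// (bigD1 m)//= {1}/A' eqxx; congr (_ * _)%E.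
rewrite big_cons big_filter big_enum_cond/= (bigD1 seller) 1?eq_sym//=.
have A'B i : i != m -> lambda (A' i) = lambda (B i).
  move=> im; rewrite /A' (negbTE im) inE mem_filter im mem_enum/= andbT.
  by rewrite orbN.
rewrite A'B 1?eq_sym//; congr (_ * _)%E; apply: eq_bigr => i /andP[im _].
exact: A'B.
Qed.

Lemma sale_event_prob j : leader X m j ->
  P [set w | sale_event X m (V^~ w) j] =
  (\int[lambda \x lambda]_z slot_prob X m j z)%E.
Proof.
move=> lj; rewrite sale_eventE// /slot_prob -integral_mkcond.
have m_notin : seller \notin others m by rewrite mem_filter eqxx andbF.
apply: (@independent_event_integral _ _ _ P _ _ lambda _ V mV (others m)
  _ _ (measurableTypeR R * measurableTypeR R)%type
  (fun w => (V m w, V seller w))).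
- by rewrite filter_uniq// enum_uniq.
- exact: (measurable_fun_pair (mV m) (mV seller)).
- exact: (@independent_from_cons _ _ _ P _ _ lambda _ V mV _
    (measurableTypeR R) (V m) lambda seller (others m) (mV m)).
- exact: measurable_sale_base.
- by move=> i; exact: measurable_sale_slot.
Qed.

(** Tonelli puts the time of [m] outside. Only 1/e < t < 1 is kept, the rest being nonnegative;
    there [slot_prob_inner] bounds the inner integral. *)
Lemma sale_event_prob_sum :
  ((1 / 4 + b ^+ 2 / 4)%:E <=
   \sum_(j <- leaders X m) P [set w | sale_event X m (V^~ w) j])%E.
Proof.
have b0 : 0 < b :> R by rewrite invr_gt0 expR_gt0.
have b1 : b < 1 :> R by rewrite invf_lt1 ?expR_gt0// expR_gt1.
rewrite (eq_big_seq
    (fun j => \int[lambda \x lambda]_z slot_prob X m j z)%E); last first.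
  by move=> j; rewrite mem_filter => /andP[lj _]; exact: sale_event_prob.
have mslot j := measurable_slot_prob R n X m j.
rewrite -ge0_integral_sum//; last by move=> j z _; exact: slot_prob_ge0.
pose H z := (\sum_(j <- leaders X m) slot_prob X m j z)%E.
have mH : measurable_fun setT H by exact: emeasurable_sum.
have H0 z : (0 <= H z)%E by apply: sume_ge0 => j _; exact: slot_prob_ge0.
rewrite fubini_tonelli1//.
rewrite integral_uniform; last 2 first.
- exact: measurable_fun_fubini_tonelli_F.
- by move=> t; apply: integral_ge0 => s _; exact: H0.
rewrite subr0 invr1 mul1e.
apply: (@le_trans _ _ (\int[lebesgue_measure]_(t in `]b, 1%R[)
    ((t + b ^+ 2 / t) / 2)%:E)%E).
  rewrite integral_outer// lee_fin lnV ?posrE ?expR_gt0// expRK.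
  by set B := (expR 1)^-1; lra.
apply: (@le_trans _ _ (\int[lebesgue_measure]_(t in `]b, 1%R[)
    fubini_F lambda H t)%E).
  apply: ge0_le_integral => //.
  - move=> t /=; rewrite in_itv/= => /andP[bt _]; have t0 := lt_trans b0 bt.
    by rewrite lee_fin divr_ge0// addr_ge0 ?divr_ge0 ?sqr_ge0 ?ltW.
  - apply/measurable_EFinP; apply: open_continuous_measurable_fun.
      exact: interval_open.
    move=> t; rewrite inE/= in_itv/= => /andP[bt _].
    exact/continuous_outer_integrand/(lt_trans b0).
  - apply: measurable_funTS; exact: measurable_fun_fubini_tonelli_F.
  - move=> t /=; rewrite in_itv/= => /slot_prob_inner; exact.
apply: ge0_subset_integral => //.
- apply: measurable_funTS; exact: measurable_fun_fubini_tonelli_F.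
- by move=> t _; apply: integral_ge0 => s _; exact: H0.
- move=> t /=; rewrite !in_itv/= => /andP[bt t1].
  by rewrite (ltW (lt_trans b0 bt)) ltW.
Qed.

(** The events for different leaders are disjoint by [sale_event_disjoint], so the probability of
    their union is the sum just bounded. *)
Lemma sale_probability :
  ((1 / 4 + b ^+ 2 / 4)%:E <=
   P [set w | exists2 j, leader X m j & sale_event X m (V^~ w) j])%E.
Proof.
apply: le_trans sale_event_prob_sum _.
rewrite /leaders big_filter big_enum_cond/= big_mkcond/=.
pose F j := if leader X m j
  then [set w | sale_event X m (V^~ w) j] else set0.
rewrite (eq_bigr (fun j => P (F j))); last first.
  by move=> j _; rewrite /F; case: ifP; rewrite ?measure0.
have mF j : measurable (F j).
  by rewrite /F; case: ifPn => // lj; exact: measurable_sale_event.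
have FE : [set w | exists2 j, leader X m j & sale_event X m (V^~ w) j]
    = \bigcup_j F j.
  apply/seteqP; split => w /=.
    by move=> [j lj Ej]; exists j; rewrite /F ?lj.
  by move=> [j _]; rewrite /F; case: ifPn => // lj; exists j.
rewrite FE.
have mFU : measurable (\bigcup_j F j) by rewrite -FE; exact: measurable_sale.
have := @sum_measure_eq _ _ _ P 'I_n.+1 unit F (fun=> \bigcup_j F j).
rewrite big_const card_unit/= adde0 => ->//.
move=> w; rewrite big_const card_unit/= addr0 indicE.
case: (boolP (w \in \bigcup_j F j)) => [|nFw]; rewrite ?inE.
  move=> [j _ Fjw]; rewrite (bigD1 j)//= big1 ?addr0.
    by rewrite indicE mem_set.
  move=> i ij; rewrite indicE memNset// => Fiw; move/eqP: ij; apply.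
  move: Fjw Fiw; rewrite /F; case: ifPn => // lj Ej; case: ifPn => // li Ei.
  exact: (@sale_event_disjoint _ _ X m X_inj _ _ _ li lj Ei Ej).
rewrite big1// => j _; rewrite indicE memNset// => Fjw.
by move: nFw; rewrite notin_setE; apply; exists j.
Qed.

End SaleEventProbability.

(* The larger integrand need not be measurable: the integral of a nonnegative
   function is a supremum over the simple functions below it. *)
Lemma ge0_le_integral_lower d (T : measurableType d) (R : realType)
    (mu : {measure set T -> \bar R}) (f g : T -> \bar R) :
  (forall x, 0 <= f x)%E -> (forall x, f x <= g x)%E ->
  (\int[mu]_x f x <= \int[mu]_x g x)%E.
Proof.
move=> f0 fg; have g0 x : (0 <= g x)%E := le_trans (f0 x) (fg x).
rewrite !ge0_integralE// !patch_setT; apply: ereal_sup_le => _ [h hf <-].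
by exists h => // x; exact: le_trans (hf x) (fg x).
Qed.

(** The same device at x = -1/4. The bound exceeds 2 - sqrt 3, which settles the case where the
    seller is the best agent. *)
Lemma invr_expR1_lb (R : realType) : (3 / 4) ^+ 4 <= (expR 1)^-1 :> R.
Proof.
have -> : (expR 1)^-1 = expR (- 4^-1) ^+ 4 :> R.
  by rewrite -expRN -expRM_natl mulrN mulfV.
rewrite lerXn2r ?nnegrE ?expR_ge0//.
by have := expR_ge1Dx (- 4^-1 : R); lra.
Qed.

(** * From event probabilities to the competitive ratio *)

Section CompetitiveRatio.
Local Open Scope classical_set_scope.
Context (R : realType) d (Omega : measurableType d) (P : probability Omega R).
Context (n : nat) (pos : Omega -> {perm 'I_n.+1}) (U : 'I_n.+1 -> {RV P >-> R}).
Hypothesis arrivals : random_arrivals pos U.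
Local Notation lambda := (uniform_prob (@ltr01 R)).

Lemma permuted_times_independent (t : {perm 'I_n.+1}) (A : 'I_n.+1 -> set R) :
  (forall i, measurable (A i)) ->
  P (\bigcap_i (U (t i) @^-1` A i)) = (\prod_(i < n.+1) lambda (A i))%E.
Proof.
move=> mA; rewrite (reindex_inj (@perm_inj _ (t^-1)%g))/=.
rewrite -(times_independent _ _ _ _ _ _ _ arrivals (fun i => A (t^-1 i)%g))//.
congr (P _); apply/seteqP; split => w /= h i _.
  by have := h (t^-1 i)%g I; rewrite /= permKV.
by have := h (t i) I; rewrite /= permK.
Qed.

Variable X : 'I_n.+1 -> R.
Hypothesis X0 : forall i, 0 <= X i.

(** A Markov-type bound: [E] is an event on the agents' arrival times that forces welfare at least
    [x]. By [order_stat_average] its probability may be computed as if the [U i], in any assignment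
    to the agents, were the arrival times. *)
Lemma rt_alg_lower_bound (E : ('I_n.+1 -> R) -> Prop) (x c : R) :
  (forall d' (T : measurableType d') (f : 'I_n.+1 -> T -> R),
    (forall i, measurable_fun setT (f i)) ->
    measurable [set w | E (fun i => f i w)]) ->
  0 <= x ->
  (forall t : {perm 'I_n.+1},
    (c%:E <= P [set w | E (fun i => U (t i) w)])%E) ->
  (forall (s : {perm 'I_n.+1}) (T : 'I_n.+1 -> R),
    (forall i j : 'I_n.+1, (i <= j)%N -> T i <= T j) ->
    E (fun i => T (s i)) -> x <= rt_welfare X s T) ->
  ((x * c)%:E <= rt_alg pos U X)%E.
Proof.
move=> mE x0 cE xE.
pose G := [set w | E (fun i => order_stat (fun j => U j w) (pos w i))].
have mG : measurable G by exact: measurable_order_stat_event.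
have cG : (c%:E <= P G)%E.
  rewrite (order_stat_average _ _ _ _ _ _ _ arrivals E mE).
  have N0 : 0 < (n.+1)`!%:R :> R by rewrite ltr0n fact_gt0.
  apply: (@le_trans _ _ ((n.+1)`!%:R^-1%:E *
      \sum_(t : {perm 'I_n.+1}) c%:E)%E).
    rewrite sumEFin sumr_const card_Sn -EFinM lee_fin -[c *+ _]mulr_natl.
    by rewrite mulKf// gt_eqF.
  rewrite lee_wpmul2l// ?lee_fin ?invr_ge0 ?(ltW N0)//.
  by apply: lee_sum => t _; exact: cE.
rewrite /rt_alg unlock.
apply: (@le_trans _ _ (\int[P]_w (x%:E * (\1_G w)%:E))%E).
  rewrite ge0_integralZl ?lee_fin//; last first.
    exact/measurable_EFinP/measurable_indic.
  by rewrite integral_indic// setIT EFinM lee_wpmul2l// lee_fin.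
apply: ge0_le_integral_lower => w; first by rewrite mule_ge0// lee_fin.
rewrite -EFinM lee_fin indicE; case: (boolP (w \in G)) => [|_]; last first.
  by rewrite mulr0 social_welfare_ge0.
rewrite inE mulr1 => Gw; apply: xE Gw => i j.
exact: order_stat_nondecreasing.
Qed.

Lemma rt_alg_ge (m : 'I_n.+1) : injective X -> (forall i, X i <= X m) ->
  ((X m * ((expR 1 ^+ 2 + 1) / (4 * expR 1 ^+ 2)))%:E <= rt_alg pos U X)%E.
Proof.
move=> X_inj m_max; set c := (_ / (4 * _)).
have e0 : 0 < expR 1 :> R := expR_gt0 1.
have cE : c = 1 / 4 + (expR 1)^-1 ^+ 2 / 4.
  by rewrite /c; field; rewrite gt_eqF.
have [ms|ms] := eqVneq m seller.
  apply: (rt_alg_lower_bound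
      (fun V => (expR 1 - 1) / expR 1 < V seller)) => //.
  - move=> d' T f mf; apply: measurable_bool_set.
    exact: measurable_fun_ltr.
  - move=> t.
    have mlt : measurable [set v : R | (expR 1 - 1) / expR 1 < v].
      by apply: measurable_bool_set; exact: measurable_fun_ltr.
    rewrite [leRHS](time_uniform arrivals (t seller) mlt).
    rewrite uniform_prob01_gt; last first.
      rewrite ler_pdivlMr// ler_pdivrMr// mul0r mul1r.
      by apply/andP; have := expR1_ge2 R; split; lra.
    rewrite lee_fin cE mulrBl mulfV ?gt_eqF//.
    have b1 : (expR 1)^-1 <= 1 :> R.
      by rewrite invf_le1//; have := expR1_ge2 R; lra.
    (* The claim is B^2 - 4B + 1 <= 0, which holds from 2 - sqrt 3 = 0.268 (rounded) up to 1; the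
       product below bounds B^2 by its chord between (3/4)^4 and 1. *)
    have := invr_expR1_lb R; set B := (expR 1)^-1 in b1 * => B0.
    have : 0 <= (B - (3 / 4) ^+ 4) * (1 - B) by rewrite mulr_ge0 ?subr_ge0.
    lra.
  - move=> s T _ sT; rewrite ms.
    by apply: keep_welfare => // i; rewrite -ms.
apply: (rt_alg_lower_bound (fun V => exists2 j, leader X m j &
    sale_event X m V j)) => //.
- move=> d' T f mf; exact: measurable_sale.
- move=> t; rewrite cE.
  apply: (sale_probability R n X m X_inj ms _ _ P (fun i => U (t i))).
    by move=> i; exact: measurable_funP.
  exact: permuted_times_independent.
- move=> s T ndT [j lj Ej].
  exact: (sale_event_welfare _ _ _ _ X_inj ms m_max s T ndT X0 j lj Ej).
Qed.

Lemma rt_ratio_le : (1 <= n)%N -> injective X ->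
  (rt_ratio pos U X <= (4 * expR 1 ^+ 2 / (expR 1 ^+ 2 + 1))%:E)%E.
Proof.
move=> n1 X_inj.
have [m m_max] : exists m, forall i, X i <= X m.
  case: (@arg_maxP _ _ _ seller xpredT X isT) => m _ m_max.
  by exists m => i; exact: m_max.
(* There are at least two agents, with distinct prices, so not all prices vanish. *)
have Xm : 0 < X m.
  rewrite lt_neqAle X0 andbT; apply/eqP => Xm.
  have X_eq0 i : X i = 0 by apply: le_anti; rewrite X0 Xm m_max.
  have /X_inj/(congr1 val)/= : X ord0 = X ord_max by rewrite !X_eq0.
  by move=> n0; rewrite -n0 in n1.
have opt_le : strong_opt X <= X m.
  by rewrite /strong_opt; apply: bigmax_le.
have opt0 : 0 <= strong_opt X.
  by apply: le_trans (X0 seller) _; exact: bigmax_ge_id.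
have e2 : 0 < expR 1 ^+ 2 :> R by rewrite exprn_gt0 ?expR_gt0.
have := rt_alg_ge m X_inj m_max; rewrite /rt_ratio.
have C0 : 0 <= 4 * expR 1 ^+ 2 / (expR 1 ^+ 2 + 1) :> R.
  by rewrite divr_ge0// ?addr_ge0 ?mulr_ge0 ?(ltW e2).
(* An infinite expected welfare would give ratio 0, and the lower bound excludes the value -oo. *)
case: (rt_alg pos U X) => [r| |//]; last by rewrite invey mule0 lee_fin.
rewrite lee_fin => alg_ge.
have r0 : 0 < r.
  apply: lt_le_trans alg_ge.
  by rewrite mulr_gt0// divr_gt0// ?addr_gt0 ?mulr_gt0.
rewrite inver gt_eqF// -EFinM lee_fin ler_pdivrMr//.
apply: le_trans opt_le _.
rewrite mulrAC ler_pdivlMr ?addr_gt0//.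
move: alg_ge; rewrite mulrA ler_pdivrMr ?mulr_gt0// => alg_ge.
by apply: le_trans alg_ge _; rewrite mulrC.
Qed.

End CompetitiveRatio.

Theorem theorem3p1 (R : realType) (d : measure_display)
    (Omega : measurableType d) (P : probability Omega R)
    (n : nat) (n_ge1 : (1 <= n)%N)
    (pos : Omega -> {perm 'I_n.+1}) (U : 'I_n.+1 -> {RV P >-> R})
    (arrivals : random_arrivals pos U) :
  (forall X : 'I_n.+1 -> R, admissible_prices X ->
     (rt_ratio pos U X
      <= (4 * expR 1 ^+ 2 / (expR 1 ^+ 2 + 1))%:E)%E) /\
  (rt_strong_competitive_ratio pos U
   <= (4 * expR 1 ^+ 2 / (expR 1 ^+ 2 + 1))%:E)%E.
Proof.
have ratio_le X : admissible_prices X ->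
    (rt_ratio pos U X <= (4 * expR 1 ^+ 2 / (expR 1 ^+ 2 + 1))%:E)%E.
  by move=> [X0 X_inj]; exact: rt_ratio_le.
split=> //; apply: ge_ereal_sup => _ [X admX <-]; exact: ratio_le.
Qed.
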